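(* Let $f,g\in\mathrm{FQSym}$ be two homogeneous elements. If $w_1(f)$ and $w_1(g)$ are stable, then so is $w_1(f\cdot g)$.
   Context: $\mathrm{FQSym}=\bigoplus_{n\geq0}\mathrm{FQSym}_n$ is the graded complex vector space where $\mathrm{FQSym}_n$ has basis $\{\pi:\pi\in\mathfrak{S}_n\}$; homogeneous elements are those lying in some $\mathrm{FQSym}_n$. Its (bilinear) product is the shuffle product: for $\pi\in\mathfrak{S}_n$, $\sigma\in\mathfrak{S}_m$ (one-line notation), $\pi\cdot\sigma$ is the sum of all permutations $\tau\in\mathfrak{S}_{n+m}$ whose one-line word is an interleaving of the words $\pi_1\cdots\pi_n$ and $(\sigma_1+n)\cdots(\sigma_m+n)$. For $\pi\in\mathfrak{S}_n$ set $\pi_0=\pi_{n+1}=\infty$, $\mathrm{AB}(\pi)=\{\pi_i\in[n]:\pi_i<\pi_{i+1}\}$, $\mathrm{DB}(\pi)=\{\pi_i\in[n]:\pi_{i-1}>\pi_i\}$, where $[n]=\{1,\dots,n\}$. With $\mathcal{E}=\{1,2,\ldots,1',2',\ldots\}$, the map $w_1:\mathrm{FQSym}\to\mathbb{C}[z_e:e\in\mathcal{E}]$ is the linear map with $w_1(\pi)=\prod_{e\in\mathrm{DB}(\pi)}z_e\prod_{e\in\mathrm{AB}(\pi)}z_{e'}$. A polynomial with complex coefficients is stable if it is nonzero whenever all its variables have positive imaginary parts. *)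

(* Defs.v *)
From HB Require Import structures.
From mathcomp Require Import all_boot all_order all_fingroup all_algebra.
From mathcomp Require Import finmap monalg complex reals.

Set Implicit Arguments.
Unset Strict Implicit.
Unset Printing Implicit Defensive.

Import GRing.Theory Num.Theory.
Local Open Scope ring_scope.

(** Permutations of all sizes.  The letters of a permutation of size n are
    0, ..., n - 1: the letter k here is the letter k + 1 of the usual one-line
    notation. *)
Definition anyperm : Type := {n : nat & 'S_n}.
HB.instance Definition _ := Choice.on anyperm.

Definition word n (p : 'S_n) : seq nat := [seq val (p i) | i <- enum 'I_n].

(** The letter at position i, positions being counted from 1.  Both at position
    0 and at position n + 1 the result is n, which is larger than every letter
    of p and plays the role of infinity. *)
Definition letter n (p : 'S_n) (i : nat) : nat := nth n (n :: word p) i.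

Definition AB n (p : 'S_n) : {fset nat} :=
  [fset letter p i | i in iota 1 n & (letter p i < letter p i.+1)%N]%fset.

Definition DB n (p : 'S_n) : {fset nat} :=
  [fset letter p i | i in iota 1 n & (letter p i.-1 > letter p i)%N]%fset.

(** w is an interleaving of u and v: some set of positions of w reads u and the
    complementary set of positions reads v. *)
Definition interleaving (u v w : seq nat) : bool :=
  [exists b : (size w).-tuple bool,
    (mask b w == u) && (mask (map negb b) w == v)].

(** The finitely supported functions from permutations to C. *)
Definition FQSym (R : realType) := {malg R[i][anyperm]}.

Definition homogeneous (R : realType) (f : FQSym R) : Prop :=
  exists n : nat, forall s : anyperm, s \in msupp f -> tag s = n.

Definition shuffle (R : realType) n m (p : 'S_n) (q : 'S_m) : FQSym R :=
  \sum_(t : 'S_(n + m) |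
        interleaving (word p) [seq (k + n)%N | k <- word q] (word t))
     << (Tagged (fun k => 'S_k) t : anyperm) >>.

Definition fqmul (R : realType) (f g : FQSym R) : FQSym R :=
  \sum_(s <- msupp f) \sum_(t <- msupp g)
     (f@_s * g@_t) *: shuffle R (tagged s) (tagged t).

(** The index set {1, 2, ...} + {1', 2', ...}: [inl k] is k + 1 and [inr k] is
    (k + 1)', in accordance with the numbering of letters from 0. *)
Definition vars : Type := (nat + nat)%type.
HB.instance Definition _ := Choice.on vars.

(** Polynomials in the commuting variables z_e, e in [vars]. *)
Definition polyE (R : realType) := {malg R[i][{cmonom vars}]}.

Definition zvar (R : realType) (e : vars) : polyE R := << ucm e >>.

Definition w1_perm (R : realType) n (p : 'S_n) : polyE R :=
  (\prod_(k <- DB p) zvar R (inl k)) * \prod_(k <- AB p) zvar R (inr k).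

Definition w1 (R : realType) (f : FQSym R) : polyE R :=
  \sum_(s <- msupp f) f@_s *: w1_perm R (tagged s).

Definition peval (R : realType) (p : polyE R) (x : vars -> R[i]) : R[i] :=
  mmap idfun (fun m : {cmonom vars} => \prod_(e <- finsupp m) x e ^+ m e) p.

Definition stable (R : realType) (p : polyE R) : Prop :=
  forall x : vars -> R[i],
    (forall e, 0 < complex.Im (x e)) -> peval p x <> 0.

(* Main.v *)
(** Write V for the set of variables of the letters of f.  Each pair (a, b) of
    consecutive letters, with an infinite letter at both ends, carries one
    variable: z_a' if a < b, and z_b if a > b.  The weight w_1 of a permutation
    is the product of the variables of these gaps.  Inserting larger letters
    into an inner gap of p, in size n, multiplies the weight by the other one of
    z_a', z_b; cutting q at a gap by smaller letters deletes the variable of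
    that gap; and the number of gaps of q that are cut is one more than the
    number of inner gaps of p that are opened.  Hence, at a point x, w_1(f g) is
    the coefficient of t^n in A(t) B(t), where B(t) = w_1(g)(x + t) and
      A(t) = t^-(n+1) prod_{e in V} (x_e + t) w_1(f)(x t / (x + t)).
    If all the x_e lie in the upper half-plane H, stability of w_1(f) and w_1(g)
    shows that A and B have no zero in the closure of H.  By Gauss-Lucas neither
    have the nonzero derivatives of A B, so all coefficients of A B up to its
    degree, in particular that of t^n, are nonzero. *)
From HB Require Import structures.
From mathcomp Require Import all_boot all_order all_fingroup all_algebra.
From mathcomp Require Import finmap monalg complex reals ring.
Require Import Defs.

Set Implicit Arguments.
Unset Strict Implicit.
Unset Printing Implicit Defensive.

Import Order.TTheory GRing.Theory Num.Theory.
Local Open Scope ring_scope.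

(** * Half-planes, Gauss-Lucas and nonvanishing coefficients *)

Lemma Im_inv_lt0 (R : rcfType) (w : R[i]) :
  0 < complex.Im w -> complex.Im w^-1 < 0.
Proof.
case: w => a b /= hb.
have h : 0 < a ^+ 2 + b ^+ 2 by rewrite ltr_wpDl ?sqr_ge0 // exprn_gt0.
by rewrite oppr_lt0 divr_gt0.
Qed.

Lemma Im_inv_gt0 (R : rcfType) (w : R[i]) :
  complex.Im w < 0 -> 0 < complex.Im w^-1.
Proof.
case: w => a b /= hb.
have h : 0 < a ^+ 2 + b ^+ 2 by rewrite ltr_wpDl ?sqr_ge0 // expr2 nmulr_rgt0.
by rewrite oppr_gt0 ltr_pdivrMr ?mul0r.
Qed.

Lemma Im_inv_le0 (R : rcfType) (w : R[i]) :
  0 <= complex.Im w -> complex.Im w^-1 <= 0.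
Proof.
case: w => a b /= hb.
by rewrite oppr_le0 divr_ge0 // addr_ge0 ?sqr_ge0.
Qed.

Lemma Im_neq0 (R : rcfType) (w : R[i]) : 0 < complex.Im w -> w != 0.
Proof. by apply: contraTneq => ->; rewrite /= ltxx. Qed.

(** The half-plane is closed so that it contains 0, where the value is the constant coefficient. *)
Definition uhp_free (R : rcfType) (p : {poly R[i]}) :=
  forall z, 0 <= complex.Im z -> p.[z] != 0.

Lemma ImD (R : rcfType) (a b : R[i]) :
  complex.Im (a + b) = complex.Im a + complex.Im b.
Proof. by case: a; case: b. Qed.

(* The logarithmic derivative of [p] at [z] is [\sum (z - r)^-1]. *)
Lemma Im_logderiv (R : rcfType) (s : seq R[i]) (z : R[i]) :
    all (fun r => complex.Im r < 0) s -> 0 <= complex.Im z ->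
    let p := \prod_(r <- s) ('X - r%:P) in
  p.[z] != 0 /\
  (if s is [::] then complex.Im (p^`().[z] / p.[z]) = 0
   else complex.Im (p^`().[z] / p.[z]) < 0).
Proof.
move=> + hz; elim: s => [|r s IH] /=.
  by rewrite big_nil -polyC1 derivC horner0 mul0r hornerC oner_neq0.
case/andP=> hr /IH[{}IH1 IH2]; rewrite big_cons.
have hzr : 0 < complex.Im (z - r) by rewrite raddfB subr_gt0 (lt_le_trans hr).
have zr0 := Im_neq0 hzr.
rewrite derivM derivXsubC mul1r hornerD !hornerM hornerXsubC.
set q := \prod_(j <- s) _ in IH1 IH2 *.
split; first by rewrite mulf_neq0.
have -> : (q.[z] + (z - r) * q^`().[z]) / ((z - r) * q.[z]) =
          (z - r)^-1 + q^`().[z] / q.[z] by field; rewrite IH1 zr0.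
rewrite ImD; have := Im_inv_lt0 hzr.
by case: (s) IH2 => [->|_ _ h2 h1]; rewrite ?addr0 // -[ltRHS]addr0 ltrD.
Qed.

(** Gauss-Lucas: all roots lie in the open lower half-plane, so every term of the logarithmic
    derivative has negative imaginary part at [z]; the size hypothesis provides at least one
    term. *)
Lemma uhp_free_deriv (R : rcfType) (p : {poly R[i]}) :
  uhp_free p -> (1 < size p)%N -> uhp_free p^`().
Proof.
move=> hp sp z hz.
have [s def_p] := closed_field_poly_normal p.
have p0 : p != 0 by rewrite -size_poly_gt0 ltnW.
have hs : all (fun r => complex.Im r < 0) s.
  apply/allP => r rs; rewrite ltNge; apply/negP => /hp.
  by rewrite -rootE def_p rootZ ?lead_coef_eq0 // root_prod_XsubC rs.
have [_] := Im_logderiv hs hz.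
rewrite def_p size_scale ?lead_coef_eq0 // size_prod_XsubC in sp.
case: s def_p hs sp => // r s def_p hs _ him.
rewrite def_p derivZ hornerZ mulf_neq0 ?lead_coef_eq0 //.
by apply: contraTneq him => ->; rewrite mul0r /= ltxx.
Qed.

(** Up to the factor k!, the coefficient is the value at 0 of the k-th derivative. *)
Lemma uhp_free_coef (R : rcfType) (p : {poly R[i]}) k :
  uhp_free p -> (k < size p)%N -> p`_k != 0.
Proof.
elim: k p => [|k IH] p hp sp; first by rewrite -horner_coef0 hp.
(* In characteristic 0, derivation lowers the degree by no more than one. *)
have sd : ((size p).-2 < size p^`())%N.
  rewrite ltnNge; apply/negP => /(nth_default 0); apply/eqP.
  rewrite coef_deriv prednK ?mulrn_eq0.
    rewrite -lead_coefE lead_coef_eq0 negb_or -size_poly_gt0.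
    by move: sp; case: (size p) => [|[]].
  by move: sp; case: (size p) => [|[]].
have : p^`()`_k != 0.
  apply: IH; first by apply: uhp_free_deriv => //; apply: leq_ltn_trans sp.
  by apply: leq_ltn_trans sd; move: sp; case: (size p) => [|[]].
by rewrite coef_deriv mulrn_eq0.
Qed.

(** * Shuffles as lists of words *)

(** Splitting off the first letter, rather than using masks, opens sums over shuffles to induction.
    The inner [fix] is there because the recursion descends in either argument. *)
Fixpoint shuffles (u : seq nat) : seq nat -> seq (seq nat) :=
  if u is a :: u' then
    fix shuffles_u v := if v is b :: v' then
        map (cons a) (shuffles u' v) ++ map (cons b) (shuffles_u v')
      else [:: u]
  else fun v => [:: v].

Lemma shuffles_nil u : shuffles u [::] = [:: u].
Proof. by case: u. Qed.

Lemma shuffles_cons a u b v :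
  shuffles (a :: u) (b :: v) =
  map (cons a) (shuffles u (b :: v)) ++ map (cons b) (shuffles (a :: u) v).
Proof. by []. Qed.

Lemma interleavingP (u v w : seq nat) :
  reflect (exists b : bitseq,
            [/\ size b = size w, mask b w = u & mask (map negb b) w = v])
          (interleaving u v w).
Proof.
apply: (iffP existsP) => [[b /andP[/eqP h1 /eqP h2]]|[b [sb h1 h2]]].
  by exists b; rewrite size_tuple.
by have /eqP sb' := sb; exists (Tuple sb'); rewrite /= h1 h2 !eqxx.
Qed.

Lemma interleaving_nil u v : interleaving u v [::] = (u == [::]) && (v == [::]).
Proof.
apply/interleavingP/andP => [[b []]|[/eqP-> /eqP->]]; last by exists [::].
by case: b => // _ <- <-.
Qed.

Lemma interleaving_cons u v c w :
  interleaving u v (c :: w) =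
    (if u is a :: u' then (a == c) && interleaving u' v w else false) ||
    (if v is b :: v' then (b == c) && interleaving u v' w else false).
Proof.
apply/interleavingP/orP => [[[|[] m] /= []]|]; first by [].
- case: u => [|a u] [sm] // [-> h1] h2; left; rewrite eqxx andTb.
  by apply/interleavingP; exists m.
- case: v => [|b v] [sm] h1 // [-> h2]; right; rewrite eqxx andTb.
  by apply/interleavingP; exists m.
case.
  case: u => // a u /andP[/eqP-> /interleavingP[m [sm h1 h2]]].
  by exists (true :: m); rewrite /= sm h1 h2.
case: v => // b v /andP[/eqP-> /interleavingP[m [sm h1 h2]]].
by exists (false :: m); rewrite /= sm h1 h2.
Qed.

Lemma mem_map_cons (a c : nat) w s :
  (c :: w \in map (cons a) s) = (a == c) && (w \in s).
Proof.
apply/mapP/andP => [[w' hw' [-> ->]] //|[/eqP-> hw]]; by exists w.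
Qed.

Lemma nil_map_cons (a : nat) s : ([::] \in map (cons a) s) = false.
Proof. by apply/mapP => -[]. Qed.

Lemma interleaving0l v w : interleaving [::] v w = (w == v).
Proof.
elim: w v => [|c w IH] v; first by rewrite interleaving_nil eqxx eq_sym.
by rewrite interleaving_cons; case: v => //= b v; rewrite IH eq_sym eqseq_cons.
Qed.

Lemma interleaving0r u w : interleaving u [::] w = (w == u).
Proof.
elim: w u => [|c w IH] u; first by rewrite interleaving_nil eqxx eq_sym andbT.
rewrite interleaving_cons orbF.
by case: u => //= b v; rewrite IH eq_sym eqseq_cons.
Qed.

Lemma mem_shuffles u v w : (w \in shuffles u v) = interleaving u v w.
Proof.
elim: u v w => [|a u IHu] v w; first by rewrite inE interleaving0l.
elim: v w => [|b v IHv] w; first by rewrite inE interleaving0r.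
rewrite shuffles_cons mem_cat; case: w => [|c w].
  by rewrite !nil_map_cons interleaving_nil.
by rewrite !mem_map_cons interleaving_cons IHu IHv.
Qed.

(** The two halves of the recursion begin with distinct letters, hence are disjoint. *)
Lemma shuffles_uniq u v : uniq (u ++ v) -> uniq (shuffles u v).
Proof.
elim: u v => [|a u IHu] v //; elim: v => [|b v IHv] // huv.
have hab : a != b.
  by move: huv; rewrite /= mem_cat inE !negb_or; case/andP=> /and3P[].
rewrite shuffles_cons cat_uniq !map_inj_uniq; try by move=> ? ? [].
rewrite IHu; last by case/andP: huv.
rewrite IHv; last first.
  apply: subseq_uniq huv; apply: (cat_subseq (subseq_refl (a :: u))).
  exact: subseq_cons.
rewrite andbT; apply/hasPn => w /mapP[w' _ ->].
by rewrite mem_map_cons (negbTE hab).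
Qed.

Lemma interleaving_perm u v w : interleaving u v w -> perm_eq w (u ++ v).
Proof.
elim: w u v => [|c w IH] u v.
  by rewrite interleaving_nil => /andP[/eqP-> /eqP->].
rewrite interleaving_cons => /orP[].
  by case: u => // a u /andP[/eqP-> /IH]; rewrite /= perm_cons.
case: v => // b v /andP[/eqP-> /IH h].
by rewrite -cat1s perm_sym -[c :: v]cat1s perm_catCA perm_cat2l perm_sym.
Qed.

Lemma word_perm_eq n (p : 'S_n) : perm_eq (word p) (iota 0 n).
Proof.
rewrite -val_enum_ord /word map_comp perm_map //.
apply: uniq_perm; rewrite ?enum_uniq //.
  by rewrite map_inj_uniq ?enum_uniq //; apply: perm_inj.
move=> i; rewrite mem_enum; apply/mapP; exists (p^-1%g i).
  by rewrite mem_enum.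
by rewrite permKV.
Qed.

Lemma size_word n (p : 'S_n) : size (word p) = n.
Proof. by rewrite (perm_size (word_perm_eq p)) size_iota. Qed.

Lemma word_uniq n (p : 'S_n) : uniq (word p).
Proof. by rewrite (perm_uniq (word_perm_eq p)) iota_uniq. Qed.

Lemma mem_word n (p : 'S_n) k : (k \in word p) = (k < n)%N.
Proof. by rewrite (perm_mem (word_perm_eq p)) mem_iota. Qed.

Lemma word_inj n : injective (@word n).
Proof.
move=> p q /eq_in_map h; apply/permP => i; apply/val_inj/h.
by rewrite mem_enum.
Qed.

Lemma word_surj n w : perm_eq w (iota 0 n) -> exists p : 'S_n, word p = w.
Proof.
move=> hw; have sw : size w = n by rewrite (perm_size hw) size_iota.
have hlt (i : 'I_n) : (nth 0 w i < n)%N.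
  have : nth 0%N w i \in w by rewrite mem_nth // sw.
  by rewrite (perm_mem hw) mem_iota.
have hinj : injective (fun i => Ordinal (hlt i)).
  move=> i j [] /eqP; rewrite nth_uniq ?sw // ?(perm_uniq hw) ?iota_uniq //.
  by move/eqP/val_inj.
exists (perm hinj); rewrite /word; apply: (@eq_from_nth _ 0%N).
  by rewrite size_map size_enum_ord sw.
move=> i; rewrite size_map size_enum_ord => hi.
rewrite (nth_map (Ordinal hi)) ?size_enum_ord // permE /=.
by rewrite nth_enum_ord.
Qed.

Lemma word_shift_perm n m (p : 'S_n) (q : 'S_m) :
  perm_eq (word p ++ [seq (k + n)%N | k <- word q]) (iota 0 (n + m)).
Proof.
rewrite iotaD add0n perm_cat ?word_perm_eq // -[in iota n m](addn0 n) iotaDl.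
under eq_map => k do rewrite addnC.
by rewrite perm_map ?word_perm_eq.
Qed.

(** Every shuffle is the word of exactly one permutation, and none is listed twice. *)
Lemma big_interleaving (S : zmodType) N u v (F : seq nat -> S) :
    perm_eq (u ++ v) (iota 0 N) ->
  \sum_(t : 'S_N | interleaving u v (word t)) F (word t) =
  \sum_(w <- shuffles u v) F w.
Proof.
move=> huv; rewrite -(big_map (@word N) (interleaving u v) F) -big_filter.
apply: perm_big; apply: uniq_perm.
- by rewrite filter_uniq // map_inj_uniq ?index_enum_uniq //; apply: word_inj.
- by rewrite shuffles_uniq // (perm_uniq huv) iota_uniq.
move=> w; rewrite mem_filter mem_shuffles andb_idr // => hw.
have [p <-] := word_surj (perm_trans (interleaving_perm hw) huv).
by rewrite map_f // mem_index_enum.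
Qed.

(** * The weight sum of all shuffles as a coefficient of a product *)

Section GapWeights.
Context (C : comNzRingType) (N : nat).
Implicit Types (x : vars -> C) (a b : nat) (u v w : seq nat).

Definition gap x a b := if (a < b)%N then x (inr a) else x (inl b).

Definition cogap x a b := if (a < b)%N then x (inl b) else x (inr a).

Lemma gapM x a b : gap x a b * cogap x a b = x (inr a) * x (inl b).
Proof. by rewrite /gap /cogap; case: ifP => // _; rewrite mulrC. Qed.

(* The letter [N] plays the role of infinity at the end of the word. *)
Fixpoint gaps x a w :=
  if w is b :: w' then gap x a b * gaps x b w' else gap x a N.

(* In each factor, ['X] stands for leaving the gap alone and [cogap x a b] for
   inserting larger letters into it. *)
Fixpoint opened_tail x a u : {poly C} :=
  if u is b :: u' then
    gap x a b *: ('X + (cogap x a b)%:P) * opened_tail x b u'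
  else (x (inr a))%:P.

(** The two outer gaps get no factor with ['X]: a large letter there yields the same variable as
    infinity. *)
Definition opened x u : {poly C} :=
  if u is a :: u' then x (inl a) *: opened_tail x a u' else 1.

(* In each factor, ['X] stands for cutting the gap by smaller letters. *)
Fixpoint cut x a v : {poly C} :=
  if v is b :: v' then ('X + (gap x a b)%:P) * cut x b v'
  else 'X + (gap x a N)%:P.

Lemma size_opened_tail x a u : (size (opened_tail x a u) <= (size u).+1)%N.
Proof.
elim: u a => [|b u IH] a /=; first exact: size_polyC_leq1.
rewrite -scalerAl (leq_trans (size_scale_leq _ _)) //.
rewrite (leq_trans (size_polyMleq _ _)) // size_XaddC /=.
by rewrite ltnS IH.
Qed.

Lemma coef_XaddCM (c : C) (p : {poly C}) k :
  (('X + c%:P) * p)`_k.+1 = p`_k + c * p`_k.+1.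
Proof. by rewrite mulrDl coefD coefXM coefCM. Qed.

(** The two terms are the two fates of the gap: left alone, or opened, where larger letters follow
    [a] and precede [b]. *)
Lemma opened_tail_cons x a b u (p : {poly C}) k :
  (opened_tail x a (b :: u) * p)`_k.+1 =
  gap x a b * (opened_tail x b u * p)`_k +
  x (inr a) * (x (inl b) * (opened_tail x b u * p)`_k.+1).
Proof.
by rewrite /= -mulrA -scalerAl coefZ coef_XaddCM mulrDr !mulrA gapM.
Qed.

Lemma cut_cons x a b v (p : {poly C}) k :
  (p * cut x a (b :: v))`_k.+1 =
  (p * cut x b v)`_k + gap x a b * (p * cut x b v)`_k.+1.
Proof. by rewrite /= mulrCA coef_XaddCM. Qed.

Lemma sum_gaps_cons x a (b : nat) (s : seq (seq nat)) :
  \sum_(w <- map (cons b) s) gaps x a w = gap x a b * \sum_(w <- s) gaps x b w.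
Proof. by rewrite big_map mulr_sumr. Qed.

Lemma sum_shuffles_nill x b v :
  \sum_(w <- shuffles [::] v) gaps x b w = (cut x b v)`_0.
Proof.
rewrite big_seq1; elim: v b => [|c v IH] b /=.
  by rewrite coefD coefX coefC /= add0r.
by rewrite IH mulrDl coefD coefXM coefCM /= add0r.
Qed.

(** With no large letters left, no gap of [u] is opened: every factor contributes its ['X]. *)
Lemma gaps_last x a u :
    (a < N)%N -> all (fun k => k < N)%N u ->
  gaps x a u = (opened_tail x a u)`_(size u).
Proof.
elim: u a => [|c u IH] a ha /= => [_|/andP[hc hu]].
  by rewrite coefC /gap ha.
rewrite IH // -scalerAl coefZ coef_XaddCM [X in _ + X](_ : _ = 0) ?addr0 //.
by rewrite nth_default ?mulr0 // size_opened_tail.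
Qed.

Variable n : nat.
Hypothesis le_nN : (n <= N)%N.
Let small := all (fun k => k < n)%N.
Let large := all (fun k => n <= k)%N.

Lemma gap_small_large x a b : (a < n <= b)%N -> gap x a b = x (inr a).
Proof. by case/andP=> ha hb; rewrite /gap (leq_trans ha hb). Qed.

Lemma gap_large_small x a b : (a < n <= b)%N -> gap x b a = x (inl a).
Proof.
by case/andP=> ha hb; rewrite /gap ltnNge (ltnW (leq_trans ha hb)).
Qed.

Lemma small_ltN u : small u -> all (fun k => k < N)%N u.
Proof. by apply: sub_all => k /leq_trans; apply. Qed.

(** The last letter read, [b], is large. Reading [a] next cuts the current gap of the large word;
    reading a large letter keeps its variable. The hypothesis on [u] is the companion statement for
    a small last letter, whose induction on [u] supplies it. *)
Lemma sum_shuffles_from_large x a u :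
    (a < n)%N -> small u ->
    (forall b v, (n <= b)%N -> large v ->
      \sum_(w <- shuffles u (b :: v)) gaps x a w =
      (opened_tail x a u * cut x b v)`_(size u)) ->
  forall b v, (n <= b)%N -> large v ->
    \sum_(w <- shuffles (a :: u) v) gaps x b w =
    x (inl a) * (opened_tail x a u * cut x b v)`_(size u).+1.
Proof.
move=> ha hu IHu b v; elim: v b => [|c v IHv] b hb => [_|/andP[hc hv]].
  rewrite shuffles_nil big_seq1 /= gap_large_small ?ha //.
  rewrite gaps_last ?small_ltN ?(leq_trans ha) // [_ * ('X + _)]mulrC.
  rewrite coef_XaddCM [X in _ + X](_ : _ = 0) ?addr0 //.
  by rewrite nth_default ?mulr0 ?size_opened_tail.
rewrite shuffles_cons big_cat /= !sum_gaps_cons IHu // IHv //.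
rewrite cut_cons mulrDr.
by rewrite gap_large_small ?ha // mulrCA.
Qed.

(** The gap of the large word before [b] is already cut, so from here on cuts and openings are equal
    in number; hence the exponent is one less than after a large letter. *)
Lemma sum_shuffles_from_small x a u b v :
    (a < n)%N -> small u -> (n <= b)%N -> large v ->
  \sum_(w <- shuffles u (b :: v)) gaps x a w =
  (opened_tail x a u * cut x b v)`_(size u).
Proof.
elim: u a b v => [|c u IH] a b v ha /=.
  move=> _ hb hv; rewrite big_seq1 /= gap_small_large ?ha // coefCM.
  by rewrite -sum_shuffles_nill big_seq1.
case/andP=> hc hu hb hv.
rewrite -[_ *: _ * _]/(opened_tail x a (c :: u)) opened_tail_cons.
rewrite -/(shuffles (c :: u) v) big_cat /= !sum_gaps_cons IH //.
rewrite sum_shuffles_from_large // => [|b' v']; last exact: IH.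
by rewrite [gap x a b]gap_small_large ?ha.
Qed.

(** For nonempty [u], opening k of its [size u - 1] inner gaps means k + 1 cuts, so the exponent of
    ['X] is (size u - 1 - k) + (k + 1), whatever k is. *)
Lemma sum_shuffles x u v :
    small u -> large v ->
  \sum_(w <- shuffles u v) gaps x N w = (opened x u * cut x N v)`_(size u).
Proof.
case: u => [|a u] /=; first by rewrite mul1r sum_shuffles_nill.
case/andP=> ha hu hv; rewrite -scalerAl coefZ sum_shuffles_from_large //.
by move=> b v'; apply: sum_shuffles_from_small.
Qed.
End GapWeights.

(** * Values and leading coefficients of the two factors *)

(** Each gap absorbs one factor t: if e is its variable and e' the other one, then x_e (t + x_e') t
    = y_e (x_e + t) (x_e' + t). *)
Lemma opened_tail_eval (F : fieldType) N (x y : vars -> F) t a u :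
    (forall e, y e * (x e + t) = x e * t) ->
    (a < N)%N -> all (fun k => k < N)%N u ->
  (opened_tail x a u).[t] * t ^+ (size u).+1 =
  gaps N y a u * ((x (inr a) + t) *
    \prod_(k <- u) ((x (inl k) + t) * (x (inr k) + t))).
Proof.
move=> hy; elim: u a => [|b u IH] a ha /= => [_|/andP[hb hu]].
  by rewrite big_nil hornerC expr1 mulr1 /gap ha hy.
rewrite big_cons hornerM hornerZ hornerD hornerX hornerC.
rewrite exprS mulrACA IH // /gap /cogap; case: ifP => _.
  by have := hy (inr a); rewrite mulrDr => /(canRL (addrK _)) e; ring: e.
by have := hy (inl b); rewrite mulrDr => /(canRL (addrK _)) e; ring: e.
Qed.

(* With [y = x t / (x + t)], this is the identity expressing A(t) through
   [w_1(f)(y)], for a single permutation. *)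
Lemma opened_eval (F : fieldType) N (x y : vars -> F) t u :
    (forall e, y e * (x e + t) = x e * t) ->
    u != [::] -> all (fun k => k < N)%N u ->
  (opened x u).[t] * t ^+ (size u).+1 =
  gaps N y N u * \prod_(k <- u) ((x (inl k) + t) * (x (inr k) + t)).
Proof.
move=> hy; case: u => [|a u] //= _ /andP[ha hu].
rewrite exprS hornerZ mulrACA (opened_tail_eval (N := N) hy) // -hy big_cons.
by rewrite /gap ltnNge ltnW //=; ring.
Qed.

(** At 0 all inner gaps are opened, so each letter contributes both its variables. *)
Lemma opened_eval0 (C : comNzRingType) (x : vars -> C) u :
  (opened x u).[0] = \prod_(k <- u) (x (inl k) * x (inr k)).
Proof.
case: u => [|a u] /=; first by rewrite big_nil hornerC.
rewrite hornerZ big_cons -mulrA; congr (_ * _).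
elim: u a => [|b u IH] a /=; first by rewrite big_nil hornerC mulr1.
rewrite big_cons hornerM hornerZ hornerD hornerX hornerC add0r gapM IH.
by rewrite -!mulrA.
Qed.

Lemma coef_opened_lead (C : comNzRingType) N (x : vars -> C) u :
    u != [::] -> all (fun k => k < N)%N u ->
  (opened x u)`_(size u).-1 = gaps N x N u.
Proof.
case: u => [|a u] //= _ /andP[ha hu].
by rewrite coefZ -(gaps_last (N := N)) // /gap ltnNge ltnW.
Qed.

Lemma cut_eval (C : comNzRingType) N (x : vars -> C) t a v :
  (cut N x a v).[t] = gaps N (fun e => x e + t) a v.
Proof.
elim: v a => [|b v IH] a /=; rewrite /gap.
  by case: ifP => _; rewrite !hornerE addrC.
by rewrite hornerM IH; case: ifP => _; rewrite !hornerE [t + _]addrC.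
Qed.

Lemma monic_cut (C : comNzRingType) N (x : vars -> C) a v :
  cut N x a v \is monic.
Proof.
elim: v a => [|b v IH] a /=; last rewrite monicMl //.
all: by rewrite -[(gap _ _ _)%:P]opprK -polyCN monicXsubC.
Qed.

Lemma size_cut (C : comNzRingType) N (x : vars -> C) a v :
  size (cut N x a v) = (size v).+2.
Proof.
elim: v a => [|b v IH] a /=; first by rewrite size_XaddC.
by rewrite size_Mmonic ?monic_cut ?IH ?size_XaddC // -size_poly_gt0 size_XaddC.
Qed.

Lemma gaps_shift (C : comNzRingType) N n (x : vars -> C) a v :
  gaps (N + n) x (a + n) [seq (k + n)%N | k <- v] =
  gaps N (fun e => x (match e with inl k => inl (k + n)%N
                                 | inr k => inr (k + n)%N end)) a v.
Proof. by elim: v a => [|b v IH] a /=; rewrite ?IH /gap ltn_add2r. Qed.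

Lemma gaps_const (C : comNzRingType) N (c : C) a w :
  gaps N (fun=> c) a w = c ^+ (size w).+1.
Proof.
by elim: w a => [|b w IH] a /=; rewrite ?IH /gap if_same // exprS.
Qed.

(** * The weight of a permutation as a product over gaps *)

Lemma gaps_prod (C : comNzRingType) N (x : vars -> C) a w :
  gaps N x a w =
  \prod_(0 <= i < (size w).+1) gap x (nth N (a :: w) i) (nth N (a :: w) i.+1).
Proof.
elim: w a => [|b w IH] a /=; first by rewrite big_nat1.
by rewrite big_nat_recl //= IH.
Qed.

Definition weight (C : comNzRingType) n (x : vars -> C) (p : 'S_n) :=
  (\prod_(k <- DB p) x (inl k)) * \prod_(k <- AB p) x (inr k).

Lemma letter_inj n (p : 'S_n) :
  {in iota 1 n &, injective (letter p)}.
Proof.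
move=> i j; rewrite !mem_iota /letter; case: i => // i; case: j => // j.
rewrite !add1n !ltnS /= => hi hj /eqP.
by rewrite nth_uniq ?size_word ?word_uniq // => /eqP->.
Qed.

Lemma letter_neq n (p : 'S_n) i : (0 < n)%N -> (i < n.+1)%N ->
  letter p i != letter p i.+1.
Proof.
move=> n0; rewrite ltnS leq_eqVlt => /orP[/eqP->|hi].
  rewrite /letter /= [nth _ (word p) n]nth_default ?size_word //.
  case: (n) p n0 => // k p _ /=.
  have : nth k.+1 (word p) k \in word p by rewrite mem_nth // size_word.
  by rewrite mem_word; apply: contraTneq => ->; rewrite ltnn.
case: i hi => [|i] hi; rewrite /letter /=.
  have : nth n (word p) 0 \in word p by rewrite mem_nth // size_word.
  by rewrite mem_word; apply: contraTneq => <-; rewrite ltnn.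
by rewrite nth_uniq ?size_word ?word_uniq // 1?ltnW // neq_ltn ltnSn.
Qed.

Lemma letter_le n (p : 'S_n) i : (letter p i <= n)%N.
Proof.
rewrite /letter; case: i => //= i; case: (ltnP i n) => hi.
  have : nth n (word p) i \in word p by rewrite mem_nth // size_word.
  by rewrite mem_word => /ltnW.
by rewrite nth_default ?size_word.
Qed.

(* For [n = 0] the word has the single gap [(0, 0)], which [gaps] counts although
   the empty permutation has weight 1. *)
Lemma weight_gaps (C : comNzRingType) n (x : vars -> C) (p : 'S_n) :
  gaps n x n (word p) = (if n == 0%N then x (inl 0%N) else 1) * weight x p.
Proof.
have iotaE : iota 1 n = index_iota 1 n.+1 by rewrite /index_iota subn1.
have lt_letter_n1 i : (letter p n.+1 < letter p i)%N = false.
  rewrite /letter /= nth_default ?size_word //.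
  by rewrite ltnNge -/(letter p i) letter_le.
have lt_letter0 i : (letter p 0 < letter p i)%N = false.
  by rewrite /letter /= ltnNge -/(letter p i) letter_le.
(* Both products are taken over the n + 1 gaps. The index added to the descents is the last gap,
   that added to the ascents the first one; neither satisfies its condition, infinity being
   largest. *)
have DBE : \prod_(k <- DB p) x (inl k) =
    \prod_(0 <= i < n.+1 | (letter p i.+1 < letter p i)%N)
      x (inl (letter p i.+1)).
  rewrite [RHS]big_mkcond big_nat_recr //= lt_letter_n1 mulr1 -big_mkcond /=.
  rewrite big_imfset /=; last first.
    by move=> i j /andP[hi _] /andP[hj _]; apply: letter_inj.
  by rewrite undup_id ?iota_uniq // big_filter iotaE big_add1.
have ABE : \prod_(k <- AB p) x (inr k) =
    \prod_(0 <= i < n.+1 | (letter p i < letter p i.+1)%N) x (inr (letter p i)).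
  rewrite [RHS]big_mkcond big_ltn //= lt_letter0 mul1r -big_mkcond /=.
  rewrite big_imfset /=; last first.
    by move=> i j /andP[hi _] /andP[hj _]; apply: letter_inj.
  by rewrite undup_id ?iota_uniq // big_filter iotaE.
rewrite /weight DBE ABE gaps_prod size_word.
have [n0|n0] := posnP n.
  subst n; rewrite !(big_mkcond (fun i => _ < _)%N) !big_nat1.
  rewrite lt_letter_n1 lt_letter0 !mulr1.
  by rewrite /gap; case: (word p) (size_word p).
rewrite mul1r !(big_mkcond (fun i => _ < _)%N) /= -big_split /=.
apply: eq_big_nat => i hi.
rewrite -/(letter p i) -[nth n (word p) i]/(letter p i.+1) /gap.
by case: ltngtP (letter_neq p n0 hi) => //; rewrite ?mulr1 ?mul1r.
Qed.

(** * Evaluation of [w1] at a point *)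

Definition meval_monom (R : realType) (x : vars -> R[i]) (m : {cmonom vars}) :=
  \prod_(e <- finsupp m) x e ^+ m e.

Lemma meval_monomEw (R : realType) (x : vars -> R[i]) (m : {cmonom vars}) d :
  (finsupp m `<=` d)%fset -> meval_monom x m = \prod_(e <- d) x e ^+ m e.
Proof.
move=> le; rewrite /meval_monom (big_fset_incl _ le) //= => e _.
by rewrite -cmE_eq0 => /eqP->.
Qed.

(** This makes evaluation at [x] a ring morphism, hence compatible with the products in
    [w1_perm]. *)
Lemma meval_monom_mmorphism (R : realType) (x : vars -> R[i]) :
  mmorphism (meval_monom x).
Proof.
split=> [m1 m2|]; last by rewrite /meval_monom mdom1 big_seq_fset0.
rewrite [LHS]/meval_monom mdomD (meval_monomEw _ (fsubsetUl _ (finsupp m2))).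
rewrite (meval_monomEw _ (fsubsetUr (finsupp m1) _)) -big_split /=.
by apply: eq_bigr => e _; rewrite cmM exprD.
Qed.

HB.instance Definition _ (R : realType) (x : vars -> R[i]) :=
  monalg.isMultiplicative.Build {cmonom vars} R[i] (meval_monom x)
    (meval_monom_mmorphism x).

Lemma pevalE (R : realType) (p : polyE R) x :
  peval p x = mmap idfun (meval_monom x) p.
Proof. by []. Qed.

Lemma peval_zvar (R : realType) (x : vars -> R[i]) e :
  mmap idfun (meval_monom x) (zvar R e) = x e.
Proof. by rewrite mmapU mul1r /meval_monom mdomU big_seq_fset1 cmUU. Qed.

Lemma peval_w1_perm (R : realType) (x : vars -> R[i]) n (p : 'S_n) :
  mmap idfun (meval_monom x) (w1_perm R p) = weight x p.
Proof.
pose E : {rmorphism polyE R -> R[i]} := mmap idfun (meval_monom x).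
rewrite /w1_perm -[LHS]/(E _) (rmorphM E); congr (_ * _);
  by rewrite [LHS](rmorph_prod E); apply: eq_bigr => k _; apply: peval_zvar.
Qed.

Lemma peval_w1 (R : realType) (f : FQSym R) x :
  peval (w1 f) x = mmap idfun (fun s => weight x (tagged s)) f.
Proof.
rewrite pevalE /w1 raddf_sum /=; apply: eq_bigr => s _.
by rewrite mmapZ /= peval_w1_perm.
Qed.

Lemma mmap_scaleU (K : choiceType) (C : comNzRingType) (h : K -> C) c k :
  mmap idfun h (c *: << k >>) = c * h k.
Proof.
rewrite (mmapEw (msuppZ_le _ _)) msuppU oner_eq0 big_seq_fset1 mcoeffZ mcoeffUU.
by rewrite mulr1.
Qed.

Lemma peval_w1_fqmul (R : realType) (f g : FQSym R) x :
  peval (w1 (fqmul f g)) x =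
  \sum_(s <- msupp f) \sum_(t <- msupp g) f@_s * g@_t *
    \sum_(r : 'S_(tag s + tag t) |
          interleaving (word (tagged s))
            [seq (k + tag s)%N | k <- word (tagged t)] (word r)) weight x r.
Proof.
rewrite peval_w1 /fqmul raddf_sum /=; apply: eq_bigr => s _.
rewrite raddf_sum /=; apply: eq_bigr => t _.
rewrite /shuffle scaler_sumr raddf_sum /= mulr_sumr; apply: eq_bigr => r _.
exact: mmap_scaleU.
Qed.

(** * Zeros and degrees of the two factors, and the product *)

Definition homogeneous_of (R : realType) (f : FQSym R) n :=
  forall s : anyperm, s \in msupp f -> tag s = n.

Section Homogeneous.
Variables (R : realType) (f : FQSym R) (n : nat).
Hypothesis hn : homogeneous_of f n.

Lemma perm_word_homog s : s \in msupp f -> perm_eq (word (tagged s)) (iota 0 n).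
Proof. by move=> /hn <-; apply: word_perm_eq. Qed.

Lemma size_word_homog s : s \in msupp f -> size (word (tagged s)) = n.
Proof. by move=> hs; rewrite size_word; apply: hn. Qed.

Lemma word_lt_homog s :
  s \in msupp f -> all (fun k => k < n)%N (word (tagged s)).
Proof.
move=> hs; apply/allP => k.
by rewrite (perm_mem (perm_word_homog hs)) mem_iota.
Qed.
End Homogeneous.

Lemma stable_gaps (R : realType) (f : FQSym R) n x :
    homogeneous_of f n -> stable (w1 f) -> (forall e, 0 < complex.Im (x e)) ->
  \sum_(s <- msupp f) f@_s * gaps n x n (word (tagged s)) != 0.
Proof.
move=> hn hf hx; pose eps := if n == 0%N then x (inl 0%N) else 1.
suff -> : \sum_(s <- msupp f) f@_s * gaps n x n (word (tagged s)) =
          eps * peval (w1 f) x.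
  rewrite mulf_neq0 //; last exact/eqP/hf.
  by rewrite /eps; case: ifP => _; [apply: Im_neq0 | apply: oner_neq0].
rewrite peval_w1 mulr_sumr; apply: eq_big_seq => s hs /=.
have -> : gaps n x n (word (tagged s)) = eps * weight x (tagged s).
  by rewrite /eps -(hn s hs) weight_gaps.
by rewrite mulrCA.
Qed.

(** At the point with all coordinates i, all words of size n have the same gap product i^(n+1). *)
Lemma stable_sum_coef (R : realType) (f : FQSym R) n :
  homogeneous_of f n -> stable (w1 f) -> \sum_(s <- msupp f) f@_s != 0.
Proof.
move=> hn hf.
have := stable_gaps (x := fun=> 'i%C) hn hf (fun=> ltr01).
apply: contraNneq => s0; under eq_big_seq => s hs.
  by rewrite gaps_const (size_word_homog hn hs); over.
by rewrite -mulr_suml s0 mul0r.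
Qed.

(** For n > 0 this is A, in a form without denominators. *)
Definition opened_sum (R : realType) (x : vars -> R[i]) (f : FQSym R) :
    {poly R[i]} :=
  \sum_(s <- msupp f) f@_s *: opened x (word (tagged s)).

Definition cut_sum (R : realType) N n (x : vars -> R[i]) (g : FQSym R) :
    {poly R[i]} :=
  \sum_(t <- msupp g)
     g@_t *: cut N x N [seq (k + n)%N | k <- word (tagged t)].

Lemma uhp_free_opened_sum (R : realType) (f : FQSym R) n x :
    homogeneous_of f n -> stable (w1 f) -> (forall e, 0 < complex.Im (x e)) ->
  uhp_free (opened_sum x f).
Proof.
move=> hn hf hx t ht; rewrite /opened_sum horner_sum.
have [n0|n0] := posnP n.
  rewrite (_ : \sum_(s <- _) _ = \sum_(s <- msupp f) f@_s).
    exact: stable_sum_coef hn hf.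
  apply: eq_big_seq => s hs; have := size_word_homog hn hs.
  by rewrite n0; case: (word _) => //= _; rewrite hornerZ hornerC mulr1.
(* The substitution below needs t invertible; at t = 0 all words have the same value and the sum
   factors. *)
have [->|t0] := eqVneq t 0.
  rewrite (_ : \sum_(s <- _) _ =
     (\sum_(s <- msupp f) f@_s) *
     \prod_(k <- iota 0 n) (x (inl k) * x (inr k))).
    rewrite mulf_neq0 ?(stable_sum_coef hn) // prodf_seq_neq0.
    by apply/allP => k _ /=; rewrite mulf_neq0 // Im_neq0.
  rewrite mulr_suml; apply: eq_big_seq => s hs; rewrite hornerZ opened_eval0.
  by rewrite (perm_big _ (perm_word_homog hn hs)).
(* This is x t / (x + t), written so that its imaginary part is visibly positive: 1/x lies in the
   open and 1/t in the closed lower half-plane. *)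
pose y e := ((x e)^-1 + t^-1)^-1.
have hy e : 0 < complex.Im (y e).
  rewrite Im_inv_gt0 // ImD -[ltRHS]addr0 ltr_leD ?Im_inv_lt0 //.
  exact: Im_inv_le0.
have hxt e : x e + t != 0 by rewrite Im_neq0 // ImD ltr_pwDl.
have yE e : y e * (x e + t) = x e * t.
  by rewrite /y; field; rewrite t0 Im_neq0 // addrC hxt.
have key : (\sum_(s <- msupp f) (f@_s *: opened x (word (tagged s))).[t]) *
    t ^+ n.+1 = (\sum_(s <- msupp f) f@_s * gaps n y n (word (tagged s))) *
    \prod_(k <- iota 0 n) ((x (inl k) + t) * (x (inr k) + t)).
  rewrite !mulr_suml; apply: eq_big_seq => s hs; rewrite hornerZ -!mulrA.
  have u0 : word (tagged s) != [::].
    by rewrite -size_eq0 (size_word_homog hn hs) -lt0n.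
  have := opened_eval yE u0 (word_lt_homog hn hs).
  by rewrite (size_word_homog hn hs) (perm_big _ (perm_word_homog hn hs)) => ->.
have : (\sum_(s <- msupp f) f@_s * gaps n y n (word (tagged s))) *
    \prod_(k <- iota 0 n) ((x (inl k) + t) * (x (inr k) + t)) != 0.
  rewrite mulf_neq0 ?(stable_gaps hn) // prodf_seq_neq0.
  by apply/allP => k _ /=; rewrite mulf_neq0.
by rewrite -key; apply: contraNneq => ->; rewrite mul0r.
Qed.

(** For n > 0 the coefficient of degree n - 1, where all inner gaps are left alone, is the gap sum
    of [f] at [x], nonzero by stability. *)
Lemma size_opened_sum (R : realType) (f : FQSym R) n x :
    homogeneous_of f n -> stable (w1 f) -> (forall e, 0 < complex.Im (x e)) ->
  (n <= size (opened_sum x f))%N.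
Proof.
case: n => // n hn hf hx; rewrite ltnNge; apply/negP => /(nth_default 0).
apply/eqP; rewrite /opened_sum coef_sum.
rewrite (_ : \sum_(s <- _) _ =
  \sum_(s <- msupp f) f@_s * gaps n.+1 x n.+1 (word (tagged s))).
  exact: stable_gaps.
apply: eq_big_seq => s hs; rewrite coefZ -(coef_opened_lead (N := n.+1)).
- by rewrite (size_word_homog hn hs).
- by rewrite -size_eq0 (size_word_homog hn hs).
- exact: (word_lt_homog hn hs).
Qed.

(** Adding [t] keeps all variables in the open upper half-plane, where stability of [w1 g]
    applies. *)
Lemma uhp_free_cut_sum (R : realType) (g : FQSym R) m n x :
    homogeneous_of g m -> stable (w1 g) -> (forall e, 0 < complex.Im (x e)) ->
  uhp_free (cut_sum (m + n) n x g).
Proof.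
move=> hm hg hx t ht; rewrite /cut_sum horner_sum.
under eq_bigr => s _ do rewrite hornerZ cut_eval gaps_shift.
by apply: stable_gaps => // -[k|k]; rewrite ImD ltr_pwDl.
Qed.

(** Each summand is a multiple of a monic polynomial of degree m + 1, so the coefficient there is
    the sum of the coefficients of [g]. *)
Lemma size_cut_sum (R : realType) N n (g : FQSym R) m x :
    homogeneous_of g m -> stable (w1 g) -> (1 < size (cut_sum N n x g))%N.
Proof.
move=> hm hg; apply: (@leq_ltn_trans m.+1) => //; rewrite ltnNge.
apply/negP => /(nth_default 0); apply/eqP; rewrite /cut_sum coef_sum.
rewrite (_ : \sum_(s <- _) _ = \sum_(s <- msupp g) g@_s).
  exact: stable_sum_coef hm hg.
apply: eq_big_seq => s hs; rewrite coefZ.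
have := monicP (monic_cut N x N [seq (k + n)%N | k <- word (tagged s)]).
rewrite lead_coefE size_cut size_map (size_word_homog hm hs) => ->.
by rewrite mulr1.
Qed.

Theorem theorem4p4 (R : realType) (f g : FQSym R)
    (f_homog : homogeneous f) (g_homog : homogeneous g)
    (f_stable : stable (w1 f)) (g_stable : stable (w1 g)) :
  stable (w1 (fqmul f g)).
Proof.
case: f_homog => n hn; case: g_homog => m hm x hx.
pose A := opened_sum x f; pose B := cut_sum (m + n) n x g.
have hA : uhp_free A by apply: uhp_free_opened_sum hn _ _.
have hB : uhp_free B by apply: uhp_free_cut_sum hm _ _.
have sA : (n <= size A)%N by apply: size_opened_sum hn _ _.
have sB : (1 < size B)%N by apply: size_cut_sum hm _.
have A0 : A != 0.
  by apply: contraTneq (hA 0 (lexx _)) => ->; rewrite horner0 eqxx.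
have B0 : B != 0.
  by apply: contraTneq (hB 0 (lexx _)) => ->; rewrite horner0 eqxx.
have : (A * B)`_n != 0.
  apply: uhp_free_coef => [z hz|]; first by rewrite hornerM mulf_neq0 ?hA ?hB.
  (* The size of [A * B] is [size A + size B - 1], at least n + 1. *)
  by rewrite size_mul // -subn1 ltn_subRL add1n -addn2 leq_add.
apply: contra_neq_not; rewrite peval_w1_fqmul => e0.
(* The factor from [weight_gaps] in size n + m: the coefficient is [eps] times the value of
   [w1 (fqmul f g)]. *)
pose eps := if (n + m == 0)%N then x (inl 0%N) else 1.
rewrite -[RHS](mulr0 eps) -[X in _ = _ * X]e0 /A /B /opened_sum /cut_sum.
rewrite mulr_suml coef_sum.
rewrite mulr_sumr; apply: eq_big_seq => s hs.
rewrite mulr_sumr coef_sum mulr_sumr; apply: eq_big_seq => t ht.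
rewrite -scalerAl -scalerAr scalerA coefZ [RHS]mulrCA; congr (_ * _).
have large : all (fun k => n <= k)%N [seq (k + n)%N | k <- word (tagged t)].
  by apply/allP => _ /mapP[k _ ->]; apply: leq_addl.
have small : all (fun k => k < n)%N (word (tagged s)).
  exact: (word_lt_homog hn hs).
have := sum_shuffles (leq_addl m n) x small large.
rewrite (size_word_homog hn hs) => <-.
rewrite /eps [(m + n)%N]addnC -(hn s hs) -(hm t ht).
rewrite -(big_interleaving _ (word_shift_perm _ _)).
by rewrite mulr_sumr; apply: eq_bigr => r _; rewrite weight_gaps.
Qed.
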